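(* Let $\kappa$ be an infinite cardinal and let $\lambda > \kappa^+$ be a regular cardinal such that $\mathrm{Col}(\lambda,\kappa)$ holds. Then there is a dense $\kappa$-bounded subspace of the Cantor cube $2^\lambda$ that has a discretely untouchable (non-isolated) point.
   Context: For infinite cardinals $\lambda,\kappa$, $\mathrm{Col}(\lambda,\kappa)$ is the statement: there is a coloring $c : [\lambda]^2 \to 2$ such that, given any ordinal $\xi < \kappa^+$ and any map $h : \xi\times\xi \to 2$, for every family $\{A_\alpha : \alpha < \lambda\}$ of $\lambda$ many pairwise disjoint subsets of $\lambda$ of order type $\xi$ there are $\alpha < \beta < \lambda$ such that $c(\{a_{\alpha,i},a_{\beta,j}\}) = h(i,j)$ for all $\langle i,j\rangle \in \xi\times\xi$, where $a_{\alpha,i}$ denotes the $i$th member of $A_\alpha$ in its increasing ordering. The Cantor cube $2^\lambda$ carries the product topology (with $2=\{0,1\}$ discrete). A space $X$ is $\kappa$-bounded if every subset of $X$ of cardinality $\le\kappa$ has compact closure in $X$. A subset of $X$ is discrete if its subspace topology is discrete. A point $x$ is an accumulation point of $A\subset X$ if every neighbourhood of $x$ contains a point of $A\setminus\{x\}$. A point $x\in X$ is discretely untouchable in $X$ if it is not an accumulation point of any discrete subset of $X$. *)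

(* Defs.v *)
From mathcomp Require Import all_boot all_order.
From mathcomp Require Import all_classical.
From mathcomp Require Import wochoice.
From mathcomp Require Import reals topology.

Set Implicit Arguments.
Unset Strict Implicit.
Unset Printing Implicit Defensive.

Import Order.TTheory.
Local Open Scope classical_set_scope.
Local Open Scope card_scope.
Local Open Scope order_scope.

(* Von Neumann ordinals are represented by well-ordered types: an ordinal below
   [T] is an element [x : T], identified with the segment of its predecessors. *)
Definition segment d (T : orderType d) (x : T) : set T := [set y | y < x].

(* A cardinal is an initial ordinal: it is not equipotent to any smaller one. *)
Definition is_cardinal d (T : orderType d) : Prop :=
  well_order (<=%O : rel T) /\ forall x : T, segment x #!= [set: T].

Definition is_infinite_cardinal d (T : orderType d) : Prop :=
  is_cardinal T /\ infinite_set [set: T].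

Definition card_lt T U (A : set T) (B : set U) : Prop :=
  A #<= B /\ A #!= B.

(* [Kplus] is the least cardinal greater than [K]. *)
Definition is_successor_cardinal d d' (K : orderType d) (Kplus : orderType d')
    : Prop :=
  [/\ is_cardinal Kplus, card_lt [set: K] [set: Kplus]
    & forall e (M : orderType e), is_cardinal M ->
        card_lt [set: K] [set: M] -> [set: Kplus] #<= [set: M] ].

Definition cofinal d (T : orderType d) (C : set T) : Prop :=
  forall x, exists2 y, C y & x <= y.

Definition is_regular_cardinal d (T : orderType d) : Prop :=
  is_infinite_cardinal T /\ forall C : set T, cofinal C -> C #= [set: T].

(* [A] has order type [xi], and [a i] is its [i]th member, for [i < xi]. *)
Definition increasing_enumeration d d' (O : orderType d) (L : orderType d')
    (xi : O) (A : set L) (a : segment xi -> L) : Prop :=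
  (forall i j : segment xi, set_val i < set_val j -> a i < a j) /\
  range a = A.

(* The coloring [c] is a total function on [set L], but only its values on
   two-element sets matter: the members of disjoint sets are distinct. An
   ordinal below the successor of [K] is an element of that successor, which
   exists and is unique up to isomorphism. *)
Definition Col d d' (L : orderType d) (K : orderType d') : Prop :=
  exists c : set L -> bool,
    forall e (Kplus : orderType e), is_successor_cardinal K Kplus ->
    forall (xi : Kplus) (h : segment xi * segment xi -> bool)
           (A : L -> set L) (a : L -> segment xi -> L),
      trivIset [set: L] A ->
      (forall alpha, increasing_enumeration (A alpha) (a alpha)) ->
      exists alpha beta : L, alpha < beta /\
        forall i j : segment xi,
          c [set a alpha i; a beta j] = h (i, j).

(* [bool] carries the discrete topology and [{ptws L -> bool}] the product. *)
Definition cantor_cube (L : Type) : topologicalType := {ptws L -> bool}.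

Definition bounded_by (K : Type) (X : topologicalType) : Prop :=
  forall S : set X, S #<= [set: K] -> compact (closure S).

(* [U] ranges over the subsets of [set_type A], whose topology is the subspace
   topology. *)
Definition discrete_subset (X : topologicalType) (A : set X) : Prop :=
  forall U : set (set_type A), open U.

Definition discretely_untouchable (X : topologicalType) (x : X) : Prop :=
  forall A : set X, discrete_subset A -> ~ limit_point A x.

(* Main.v *)
(* Let [c] be the coloring. For [N] a subset of [lambda], let [columns c N] be
   the set of points [z] that, for some [b] in [N], vanish on [[b, lambda)] and
   agree with [c {., b}] below [b] off [N]; let [Y] be the union of the closures
   of all [columns c N] with [|N| <= kappa], and [X] be [Y] together with the
   constant point 1. [Y] is dense because any finite condition can be absorbed
   in [N], and it is [kappa]-bounded because [kappa * kappa = kappa].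
   If 1 were an accumulation point of a discrete subset of [X], one could choose
   for each [x < lambda] a point [y x] of it with [y x x = 1], in the closure of
   [columns c (N x)], isolated by a finite condition on [s x]. Pressing down and
   pigeonholing yield [c0] such that, for unboundedly many [x], [N x] and [s x]
   miss [[c0, x)] and the conditions agree below [c0] and have the same pattern
   above [x], where the sets [N x] can be thinned out to be disjoint. [Col]
   then gives two indices for which every candidate for [y x'] copies [y x] on
   [s x], so that [y x'] lies in the neighbourhood isolating [y x]. *)

Require Import Defs.
From mathcomp Require Import all_boot all_order.
From mathcomp Require Import all_classical wochoice.
From mathcomp Require Import reals topology.

Set Implicit Arguments.
Unset Strict Implicit.
Unset Printing Implicit Defensive.

Import Order.TTheory.
Local Open Scope classical_set_scope.
Local Open Scope card_scope.
Local Open Scope order_scope.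

(** * Comparison of cardinalities through maps *)

Lemma card_le_surj T U (A : set T) (B : set U) (f : U -> T) :
  A `<=` f @` B -> A #<= B.
Proof.
by move=> /subset_card_le sAB; apply: (card_le_trans sAB); exact: card_image_le.
Qed.

Lemma card_le_inj T U (A : set T) (B : set U) (f : T -> U) :
  (forall x, A x -> B (f x)) ->
  (forall x y, A x -> A y -> f x = f y -> x = y) -> A #<= B.
Proof.
move=> fAB f_inj.
have /card_eqPle[_ /card_le_trans] : f @` A #= A.
  by apply: inj_card_eq => x y /set_mem Ax /set_mem Ay; exact: f_inj.
by apply; apply: subset_card_le => _ [x Ax <-]; exact: fAB.
Qed.

Lemma card_le_cover T U (A : set T) (B : set U) :
  A #<= B -> A !=set0 -> exists f : U -> T, A `<=` f @` B.
Proof.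
move=> /pfcard_geP[->|[f]] [a Aa]; first by [].
by exists f => x Ax; have := @surj _ _ _ _ f; apply.
Qed.

Lemma card_le_setX T T' U U' (A : set T) (A' : set T') (B : set U)
    (B' : set U') :
  A #<= A' -> B #<= B' -> A `*` B #<= A' `*` B'.
Proof.
have [->|/set0P A0] := eqVneq A set0.
  by rewrite set0X => _ _; exact: card_ge0.
have [->|/set0P B0] := eqVneq B set0.
  by rewrite setX0 => _ _; exact: card_ge0.
move=> /card_le_cover/(_ A0)[f fA] /card_le_cover/(_ B0)[g gB].
apply: (@card_le_surj _ _ _ _ (fun p => (f p.1, g p.2))) => -[x y] [/= Ax By].
by have [[x' ? <-] [y' ? <-]] := (fA x Ax, gB y By); exists (x', y').
Qed.

(** * Well-founded recursion, well-orders and the ordering of pairs *)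

Lemma wf_minimal T (R : T -> T -> Prop) :
  (forall P : set T, P !=set0 -> exists2 m, P m & forall y, P y -> ~ R y m) ->
  well_founded R.
Proof.
move=> Rmin; apply: contrapT => /existsNP[x0 nAcc].
have [m nAccm mmin] := Rmin [set x | ~ Acc R x] (ex_intro _ x0 nAcc).
by apply: nAccm; constructor => y Rym; apply: contrapT => /mmin.
Qed.

(** Each value depends only on the set of earlier values, which is all that a greedy transfinite
    choice needs to know. *)
Lemma wf_rec T (U : choiceType) (R : T -> T -> Prop) (F : set U -> U) :
  well_founded R ->
  exists t : T -> U, forall x, t x = F (t @` [set y | R y x]).
Proof.
move=> wfR.
pose step x (rec : forall y, R y x -> U) :=
  F [set u | exists y, exists Ryx : R y x, rec y Ryx = u].
exists (Fix wfR (fun=> U) step) => x; rewrite Fix_eq => [|{}x f g fg].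
  congr F; apply/seteqP; split=> u /=.
    by move=> [y [Ryx <-]]; exists y.
  by move=> [y Ryx <-]; exists y, Ryx.
by congr F; apply/seteqP; split=> u [y [Ryx <-]]; exists y, Ryx; rewrite fg.
Qed.

Lemma wo_minimum d (T : orderType d) (P : set T) :
  well_order (<=%O : rel T) -> P !=set0 ->
  exists2 m, P m & forall x, P x -> m <= x.
Proof.
move=> wo [x Px]; have [|m [[/asboolP Pm mle] _]] := wo (fun x => `[<P x>]).
  by exists x; apply/asboolP.
by exists m => // y Py; apply: mle; apply/asboolP.
Qed.

Lemma wo_wf d (T : orderType d) :
  well_order (<=%O : rel T) -> well_founded (fun x y : T => x < y).
Proof.
move=> wo; apply: wf_minimal => P /(wo_minimum wo)[m Pm mle].
by exists m => // y /mle; rewrite leNgt => /negP.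
Qed.

(* Goedel's order on pairs, under which the predecessors of [p] lie in the
   square on the elements up to [max p.1 p.2]. *)
Definition pair_lt d (T : orderType d) (p q : T * T) : Prop :=
  let m (r : T * T) := Order.max r.1 r.2 in
  m p < m q \/ (m p = m q /\ (p.1 < q.1 \/ (p.1 = q.1 /\ p.2 < q.2))).

(** Minimizing in turn the maximum, the first and the second coordinate reaches a minimal pair. *)
Lemma pair_lt_wf d (T : orderType d) :
  well_order (<=%O : rel T) -> well_founded (@pair_lt d T).
Proof.
move=> wo; apply: wf_minimal => P [p Pp].
pose m (r : T * T) := Order.max r.1 r.2.
have [_ [p1 Pp1 <-] min1] := wo_minimum wo
  (ex_intro (m @` P) (m p) (ex_intro2 _ _ p Pp erefl)).
pose P1 := P `&` [set q | m q = m p1].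
have [_ [p2 [Pp2 mp2] <-] min2] := wo_minimum wo
  (ex_intro (fst @` P1) p1.1 (ex_intro2 _ _ p1 (conj Pp1 erefl) erefl)).
pose P2 := P1 `&` [set q | q.1 = p2.1].
have [_ [p3 [[Pp3 mp3] fp3] <-] min3] := wo_minimum wo
  (ex_intro (snd @` P2) p2.2
    (ex_intro2 _ _ p2 (conj (conj Pp2 mp2) erefl) erefl)).
exists p3 => // q Pq [|[mq]].
  by rewrite -/(m q) -/(m p3) mp3 ltNge min1//; exists q.
have P1q : P1 q by split=> //=; rewrite /m mq.
move=> [|[fq]]; first by rewrite fp3 ltNge min2//; exists q.
by rewrite ltNge min3//; exists q => //; split=> //=; rewrite fq.
Qed.

Lemma pair_lt_total d (T : orderType d) (p q : T * T) :
  p <> q -> pair_lt p q \/ pair_lt q p.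
Proof.
move=> pq; rewrite /pair_lt.
case: (ltgtP (Order.max p.1 p.2) (Order.max q.1 q.2)) => [||e];
  [by left; left|by right; left|].
case: (ltgtP p.1 q.1) => [||e1];
  [by left; right; split=> //; left|by right; right; split=> //; left|].
case: (ltgtP p.2 q.2) => [||e2];
  [by left; right; split=> //; right|by right; right; split=> //; right|].
by case: pq; rewrite [p]surjective_pairing [q]surjective_pairing e1 e2.
Qed.

(** * Hessenberg's theorem and unions of few small sets *)

Lemma card_setX_initial d (T : orderType d) (D : set T) :
  well_order (<=%O : rel T) -> infinite_set D ->
  (forall x y, D y -> x <= y -> D x) ->
  (forall y, D y -> ~ (D #<= segment y)) ->
  (forall y, D y -> infinite_set (segment y) ->
    segment y `*` segment y #<= segment y) ->
  D `*` D #<= D.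
Proof.
move=> wo Dinf Ddown Dinit IH.
have [x0 Dx0] := infinite_setN0 Dinf.
have [t tE] := wf_rec (fun V => xget x0 (D `\` V)) (pair_lt_wf wo).
have ltX p : D p.1 -> D p.2 -> ~ (D #<= [set q | pair_lt q p]).
  move=> Dp1 Dp2; set m := Order.max p.1 p.2.
  have Dm : D m by rewrite /m; case: leP.
  pose I := [set y | y <= m].
  have sub : [set q | pair_lt q p] `<=` I `*` I.
    move=> q qp; suff : Order.max q.1 q.2 <= m by rewrite ge_max => /andP.
    by case: qp => [/ltW|[-> _]].
  move=> /card_le_trans/(_ (subset_card_le sub)) DI.
  have IE : I = m |` segment m.
    by apply/seteqP; split=> y; rewrite /I /segment /= le_eqVlt;
      [move=> /orP[/eqP|]; [left|right]|move=> [->|->]; rewrite ?eqxx ?orbT].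
  have [fin|inf] := pselect (finite_set (segment m)).
    apply: Dinf; apply: (card_le_finite DI); apply: finite_setX;
      by rewrite IE finite_setU.
  apply: (Dinit m Dm); apply: (card_le_trans DI).
  suff Im : I #<= segment m.
    by apply: (card_le_trans (card_le_setX Im Im)); exact: IH.
  apply: (card_le_trans _ (IH m Dm inf)).
  (* The extra point [m] is absorbed by embedding [I] into the square of [segment m]: each [y] below
     [m] goes to [(a, y)], and [m] to [(b, a)] with [b] different from [a]. *)
  have [a ma] := infinite_setN0 inf.
  have [b [mb /eqP ab]] := infinite_setN0 (infinite_setD inf (finite_set1 a)).
  apply: (@card_le_inj _ _ _ _ (fun y => if y == m then (b, a) else (a, y))).
    by move=> y; rewrite IE => -[->|my]; rewrite ?eqxx//; case: eqP.
  move=> x y _ _; case: eqP => [->|_]; case: eqP => [->|_] // [].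
  - by move=> ba; rewrite ba eqxx in ab.
  - by move=> ba; rewrite ba eqxx in ab.
  - by [].
have tP p : D p.1 -> D p.2 -> (D `\` (t @` [set q | pair_lt q p])) (t p).
  move=> Dp1 Dp2; rewrite [in X in _ X]tE; apply: xgetPex.
  apply: contrapT => none; apply: (ltX p Dp1 Dp2).
  apply: (@card_le_surj _ _ _ _ t) => y Dy; apply: contrapT => nt.
  by apply: none; exists y.
apply: (@card_le_inj _ _ _ _ t) => [p [Dp1 Dp2]|].
  by have [] := tP p Dp1 Dp2.
move=> p q [Dp1 Dp2] [Dq1 Dq2] tpq; apply: contrapT => /pair_lt_total[] lt.
  by have [_ []] := tP q Dq1 Dq2; exists p.
by have [_ []] := tP p Dp1 Dp2; exists q.
Qed.

(** By induction on [x]: if an earlier segment is as large, its square bound transfers; otherwise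
    [card_setX_initial] applies. *)
Lemma card_setX_segment d (T : orderType d) (x : T) :
  well_order (<=%O : rel T) -> infinite_set (segment x) ->
  segment x `*` segment x #<= segment x.
Proof.
move=> wo; elim/(well_founded_ind (wo_wf wo)): x => x IH xinf.
have [[y yx xy]|init] := pselect (exists2 y, y < x & segment x #<= segment y).
  apply: (card_le_trans (card_le_setX xy xy)).
  have yinf : infinite_set (segment y) by move=> /(card_le_finite xy).
  apply: (card_le_trans (IH y yx yinf)); apply: subset_card_le => z /= zy.
  exact: lt_trans yx.
apply: card_setX_initial => //.
- by move=> y z /= zx yz; exact: le_lt_trans zx.
- by move=> y yx xy; apply: init; exists y.
Qed.

Lemma card_setX_cardinal d (K : orderType d) :
  is_infinite_cardinal K -> [set: K] `*` [set: K] #<= [set: K].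
Proof.
move=> [[wo init] Kinf]; apply: card_setX_initial => //.
- move=> y _ Ky; have /negP := init y; apply.
  by rewrite card_eq_le Ky card_leT.
- by move=> y _; exact: card_setX_segment.
Qed.

Lemma card_bigcup_le d (K : orderType d) I T (J : set I) (F : I -> set T) :
  is_infinite_cardinal K -> J #<= [set: K] ->
  (forall i, J i -> F i #<= [set: K]) -> \bigcup_(i in J) F i #<= [set: K].
Proof.
move=> Kinf JK FK.
have [->|/set0P[x [j Jj _]]] := eqVneq (\bigcup_(i in J) F i) set0.
  exact: card_ge0.
apply: card_le_trans (card_setX_cardinal Kinf).
have [f fJ] := card_le_cover JK (ex_intro _ j Jj).
have /choice[g gF] : forall i, exists g : K -> T, J i -> F i `<=` range g.
  move=> i; have [->|/set0P F0] := eqVneq (F i) set0.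
    by exists (fun=> x) => _ y [].
  have [Ji|nJi] := pselect (J i); last by exists (fun=> x).
  by have [g gF] := card_le_cover (FK i Ji) F0; exists g => _.
apply: (@card_le_surj _ _ _ _ (fun p => g (f p.1) p.2)) => y [i Ji Fy].
have [k _ fk] := fJ i Ji; have [l _ gl] := gF i Ji y Fy.
by exists (k, l) => //=; rewrite fk.
Qed.

Lemma card_setU_le d (K : orderType d) T (A B : set T) :
  is_infinite_cardinal K -> A #<= [set: K] -> B #<= [set: K] ->
  A `|` B #<= [set: K].
Proof.
move=> Kinf AK BK; rewrite -bigcup2E.
apply: (@card_bigcup_le _ K _ _ _ (bigcup2 A B)) => //.
  exact/infiniteP/Kinf.2.
by move=> [|[|i]] //= _; exact: card_ge0.
Qed.

Lemma finite_card_le d (K : orderType d) T (A : set T) :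
  is_infinite_cardinal K -> finite_set A -> A #<= [set: K].
Proof.
move=> [_ /infiniteP Kinf] /finite_set_leP[n An].
by apply: card_le_trans Kinf; apply: card_le_trans An (card_leT _).
Qed.

(* When [L] is a regular cardinal, this says that [V] has fewer elements
   than [L]. *)
Definition small d (L : orderType d) U (V : set U) : Prop :=
  forall f : U -> L, exists b, forall x, V x -> f x < b.

(** * Closure properties of small sets and a pigeonhole principle *)

Lemma regular_small d (L : orderType d) U (V : set U) :
  is_regular_cardinal L -> card_lt V [set: L] -> small L V.
Proof.
move=> [_ Lreg] [VL VnL] f; apply: contrapT => unb.
have cofV : cofinal (f @` V).
  move=> b; apply: contrapT => nb; apply: unb; exists b => x Vx.
  rewrite ltNge; apply/negP => bx; apply: nb.
  by exists (f x) => //; exists x.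
move: VnL => /negP; apply; rewrite card_eq_le VL /=.
have /card_eqPle[_ LV] := Lreg _ cofV.
exact: card_le_trans LV (card_image_le _ _).
Qed.

Lemma small_le d (L : orderType d) U W (V : set U) (V' : set W) :
  inhabited L -> V #<= V' -> small L V' -> small L V.
Proof.
move=> [x0] VV' sV' f; have [->|/set0P V0] := eqVneq V set0; first by exists x0.
have [g gV] := card_le_cover VV' V0; have [b fb] := sV' (f \o g).
by exists b => x /gV[y /fb fgb <-].
Qed.

Lemma small_setX d (L : orderType d) U W (V : set U) (V' : set W) :
  small L V -> small L V' -> small L (V `*` V').
Proof.
move=> sV sV' f.
have /choice[g fg] : forall x, exists b, forall y, V' y -> f (x, y) < b.
  by move=> x; exact: (sV' (fun y => f (x, y))).
have [b gb] := sV g; exists b => -[x y] [/= Vx Vy].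
exact: lt_trans (fg x y Vy) (gb x Vx).
Qed.

Lemma small_bigcup d (L : orderType d) I U (J : set I) (F : I -> set U) :
  small L J -> (forall i, small L (F i)) -> small L (\bigcup_(i in J) F i).
Proof.
move=> sJ sF f; have /choice[g fg] := fun i => sF i f.
have [b gb] := sJ g; exists b => x [i Ji Fx].
exact: lt_trans (fg i x Fx) (gb i Ji).
Qed.

(** Induction on the length; this counts the patterns that finite conditions can have. *)
Lemma small_seq d (L : orderType d) (U : eqType) (V : set U) :
  small L [set: nat] -> small L V ->
  small L [set s : seq U | forall x, x \in s -> V x].
Proof.
move=> snat sV.
pose F n := [set s : seq U | size s = n /\ forall x, x \in s -> V x].
suff sF n : small L (F n).
  move=> f; have [b fb] := small_bigcup snat sF f.
  by exists b => s Vs; apply: fb; exists (size s).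
elim: n => [|n IHn] f.
  have [b fb] := snat (fun=> f [::]).
  by exists b => s [/size0nil-> _]; exact: (fb 0%N).
have [b fb] := small_setX sV IHn (fun p => f (p.1 :: p.2)).
exists b => -[[]//|x s [/= [sn] Vxs]]; apply: (fb (x, s)); split=> /=.
  by apply: Vxs; rewrite mem_head.
by split=> // y ys; apply: Vxs; rewrite inE ys orbT.
Qed.

(** If every fibre were bounded, smallness of [V] would give one bound for all of [T]. *)
Lemma cofinal_pigeonhole d (L : orderType d) (x0 : L) U (V : set U) (T : set L)
    (f : L -> U) :
  small L V -> cofinal T -> (forall x, T x -> V (f x)) ->
  exists2 v, V v & cofinal (T `&` [set x | f x = v]).
Proof.
move=> sV cT fV; apply: contrapT => none.
have /choice[g gP] : forall v, exists b,
    V v -> forall x, T x -> f x = v -> x < b.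
  move=> v; have [Vv|nVv] := pselect (V v); last by exists x0.
  apply: contrapT => nb; apply: none; exists v => // b.
  apply: contrapT => nbb; apply: nb; exists b => _ x Tx fx.
  by rewrite ltNge; apply/negP => bx; apply: nbb; exists x.
have [b gb] := sV g; have [x Tx bx] := cT b.
have := lt_trans (gP _ (fV x Tx) x Tx erefl) (gb _ (fV x Tx)).
by rewrite ltNge bx.
Qed.

(** * Pressing down, order types and thinning in a regular cardinal *)

Section RegularCardinal.
Context {d : Order.disp_t} {L : orderType d}.
Hypothesis Lreg : is_regular_cardinal L.

Let Lwo : well_order (<=%O : rel L) := Lreg.1.1.1.

Lemma regular_inhabited : inhabited L.
Proof. by have [x _] := infinite_setN0 Lreg.1.2; constructor. Qed.

Lemma small_segment (x : L) : small L (segment x).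
Proof.
apply: regular_small => //; split; [exact: card_leT|exact: Lreg.1.1.2].
Qed.

(** Iterate from [x0] a map [h] that exceeds both [x] and the values of [g] below [x]. The least
    upper bound of the iterates is closed. *)
Lemma closed_points_cofinal (g : L -> L) :
  small L [set: nat] -> cofinal [set x : L | forall y, y < x -> g y <= x].
Proof.
move=> snat x0.
have /choice[h hP] : forall x, exists b, x < b /\ forall y, y < x -> g y < b.
  move=> x; have [b gb] := small_segment x g.
  (* A two-valued sequence yields a strict upper bound of both [x] and [b]. *)
  have [b' bb'] := snat (fun n => if n is 0%N then x else b).
  exists b'; split=> [|y yx]; first exact: (bb' 0%N).
  exact: lt_trans (gb y yx) (bb' 1%N I).
pose s n := iter n h x0.
have [b sb] := snat s.
have [m sm mmin] := wo_minimum Lwo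
  (ex_intro (fun u => forall n, s n <= u) b (fun n => ltW (sb n I))).
exists m; last exact: (sm 0%N).
move=> y ym; have [n yn] : exists n, y < s n.
  apply: contrapT => nb; suff /mmin : forall n, s n <= y by rewrite leNgt ym.
  by move=> n; rewrite leNgt; apply/negP => ysn; apply: nb; exists n.
exact: le_trans (ltW ((hP _).2 _ yn)) (sm n.+1).
Qed.

(* The least [delta] below which there are more than [K] closed points of [g]
   has cofinality greater than [K]: it replaces a point of cofinality [K^+] in
   Fodor's argument. *)
Lemma pressing_down d1 d2 (K : orderType d1) (Kplus : orderType d2)
    (N : L -> set L) :
  is_infinite_cardinal K -> ~ ([set: Kplus] #<= [set: K]) ->
  card_lt [set: Kplus] [set: L] -> small L [set: nat] ->
  (forall x, N x #<= [set: K]) ->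
  exists c, cofinal [set x | forall y, N x y -> y < x -> y < c].
Proof.
move=> Kinf KK KL snat NK; apply: contrapT => none.
(* If no [c] worked, then from [g c] on every [N x] would have an element in the interval from [c]
   to [x]. *)
have /choice[g gP] : forall c, exists b, forall x, b <= x ->
    exists y, [/\ N x y, c <= y & y < x].
  move=> c; apply: contrapT => nb; apply: none; exists c => b.
  apply: contrapT => nbb; apply: nb; exists b => x bx.
  apply: contrapT => nx; apply: nbb; exists x => // y Ny yx.
  by rewrite ltNge; apply/negP => cy; apply: nx; exists y.
pose C := [set x | forall y, y < x -> g y <= x].
have Ccof : cofinal C := closed_points_cofinal g snat.
(* [C] has the size of [L], so it contains a copy of [Kplus], which is bounded because [Kplus] is
   smaller than [L]. *)
have [b bP] : exists b, ~ (C `&` segment b #<= [set: K]).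
  apply: contrapT => nb; apply: KK.
  have /card_eqPle[_ LC] := Lreg.2 _ Ccof.
  have /card_subP[C' C'K C'C] := card_le_trans KL.1 LC.
  move/card_eqPle: C'K => [C'K KC']; apply: (card_le_trans KC').
  have [b C'b] := small_le regular_inhabited C'K (regular_small Lreg KL) id.
  apply: (@card_le_trans _ _ _ (C `&` segment b)).
    by apply: subset_card_le => x C'x; split; [exact: C'C|exact: C'b].
  by apply: contrapT => nK; apply: nb; exists b.
have [x xP xmin] := wo_minimum Lwo
  (ex_intro (fun x => ~ (C `&` segment x #<= [set: K])) b bP).
have ltK y : y < x -> C `&` segment y #<= [set: K].
  by move=> yx; apply: contrapT => /xmin; rewrite leNgt yx.
have leK y : y < x -> y |` (C `&` segment y) #<= [set: K].
  move=> yx; apply: (@card_setU_le _ K) => //; last exact: ltK.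
  by apply: finite_card_le => //; exact: finite_set1.
have le_segE y z : C z -> z <= y -> (y |` (C `&` segment y)) z.
  by move=> Cz; rewrite le_eqVlt => /orP[/eqP ->|]; [left|right].
(* Between any closed point below [x] and [x] itself there is an element of [N x]. So [C] below [x]
   is covered by at most [K] sets of size at most [K], against the choice of [x]. *)
apply: (xP); apply: (@card_le_trans _ _ _
    (\bigcup_(y in N x `&` segment x) (y |` (C `&` segment y)))); last first.
  apply: (card_bigcup_le Kinf) => [|y [_ yx]]; last exact: leK.
  by apply: card_le_trans (NK x); apply: subset_card_le; exact: subIsetl.
apply: subset_card_le => z [Cz zx].
(* There is no last closed point below [x]: otherwise [leK] would bound all of them. The next one,
   [z'], ensures that [g z] is below [x]. *)
have [z' [Cz' z'x zz']] : exists z', [/\ C z', z' < x & z < z'].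
  apply: contrapT => nz'; apply: xP; apply: card_le_trans (leK z zx).
  apply: subset_card_le => w [Cw wx]; apply: le_segE => //.
  by rewrite leNgt; apply/negP => zw; apply: nz'; exists w.
have [y [Ny zy yx]] := gP z x (ltW (le_lt_trans (Cz' z zz') z'x)).
by exists y => //; exact: le_segE.
Qed.

(** List [A] along [Kplus], always taking the least element left. The list ends, since otherwise
    [Kplus] would inject into [A]; [xi] is the first stage with nothing left. *)
Lemma order_type_lt_succ d1 d2 (K : orderType d1) (Kplus : orderType d2)
    (A : set L) :
  well_order (<=%O : rel Kplus) -> ~ ([set: Kplus] #<= [set: K]) ->
  A #<= [set: K] ->
  exists xi : Kplus, exists e : Kplus -> L,
    (forall i j, i < j -> j < xi -> e i < e j) /\ e @` segment xi = A.
Proof.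
move=> Pwo KK AK; have [x0] := regular_inhabited.
pose least V := [set m | (A `\` V) m /\ forall y, (A `\` V) y -> m <= y].
have [e eE] := wf_rec (fun V => xget x0 (least V)) (wo_wf Pwo).
have eP i : ~ (A `<=` e @` segment i) -> least (e @` segment i) (e i).
  move=> /existsNP[y /not_implyP[Ay ny]]; rewrite [in X in _ X]eE.
  apply: xgetPex.
  have [m ? ?] := wo_minimum Lwo
    (ex_intro (A `\` (e @` segment i)) y (conj Ay ny)).
  by exists m.
have [i0 Ai0] : exists i, A `<=` e @` segment i.
  apply: contrapT => none; apply: KK; apply: card_le_trans AK.
  have {}eP i : least (e @` segment i) (e i).
    by apply: eP => Ai; apply: none; exists i.
  apply: (@card_le_inj _ _ _ _ e) => [i _|i j _ _ eij].
    by have [[]] := eP i.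
  case: (ltgtP i j) => // ij.
    by have [[_ nj] _] := eP j; case: nj; exists i.
  by have [[_ ni] _] := eP i; case: ni; exists j.
have [xi Axi ximin] := wo_minimum Pwo
  (ex_intro (fun i => A `<=` e @` segment i) i0 Ai0).
have {}eP i : i < xi -> least (e @` segment i) (e i).
  by move=> ixi; apply: eP => /ximin; rewrite leNgt ixi.
exists xi, e; split=> [i j ij jxi|]; last first.
  apply/seteqP; split=> // _ [i ixi <-]; by have [[]] := eP i ixi.
have [[Aj nj] _] := eP j jxi; have [_] := eP i (lt_trans ij jxi).
move=> /(_ (e j)); rewrite le_eqVlt => /(_ _)/orP[|/eqP eij|//].
  by split=> // -[k ki ek]; apply: nj; exists k => //; exact: lt_trans ij.
by case: nj; exists i.
Qed.

(** At each stage the bounds set by earlier choices form a small set, so [T] still has a point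
    beyond them. *)
Lemma cofinal_thin (T : set L) (b : L -> L) : cofinal T ->
  exists t : L -> L, (forall x, T (t x)) /\ forall x y, x < y -> b (t x) <= t y.
Proof.
move=> Tcof; have [x0] := regular_inhabited.
pose next V := [set z | T z /\ forall x, V x -> b x <= z].
have [t tE] := wf_rec (fun V => xget x0 (next V)) (wo_wf Lwo).
suff tP y : next (t @` segment y) (t y).
  exists t; split=> [x|x y xy]; first by have [] := tP x.
  by have [_] := tP y; apply; exists x.
rewrite [in X in _ X]tE; apply: xgetPex.
have [c tc] := small_segment y (b \o t); have [z Tz cz] := Tcof c.
exists z; split=> // _ [x xy <-]; exact: le_trans (ltW (tc x xy)) cz.
Qed.

End RegularCardinal.

(** * Columns of the coloring and the use of [Col] *)

Definition columns d (L : orderType d) (c : set L -> bool) (N : set L) :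
    set (cantor_cube L) :=
  [set z : cantor_cube L | exists b, [/\ N b, forall a, b <= a -> z a = false
    & forall a, a < b -> ~ N a -> z a = c [set a; b]]].

Lemma columns_subset d (L : orderType d) (c : set L -> bool) (N M : set L) :
  N `<=` M -> columns c N `<=` columns c M.
Proof.
move=> NM z [b [Nb z0 zc]]; exists b; split=> // [|a ab nMa]; first exact: NM.
by apply: zc => // /NM.
Qed.

(** The combinatorial core, free of topology: the hypothesis on [r] puts [y x] in the closure of
    [columns c (N x)], and the conclusion prevents all the [s x] from isolating their [y x] among
    these points. *)
Lemma columns_clash d d1 d2 (L : orderType d) (K : orderType d1)
    (Kplus : orderType d2) (c : set L -> bool)
    (y : L -> cantor_cube L) (N : L -> set L) (s : L -> seq L) :
  is_infinite_cardinal K -> is_successor_cardinal K Kplus ->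
  is_regular_cardinal L -> card_lt [set: Kplus] [set: L] ->
  (forall (xi : Kplus) (h : segment xi * segment xi -> bool)
          (A : L -> set L) (a : L -> segment xi -> L),
     trivIset [set: L] A ->
     (forall alpha, increasing_enumeration (A alpha) (a alpha)) ->
     exists alpha beta : L, alpha < beta /\
       forall i j : segment xi, c [set a alpha i; a beta j] = h (i, j)) ->
  (forall x, N x #<= [set: K]) ->
  (forall x (r : seq L), exists2 z, columns c (N x) z & {in r, z =1 y x}) ->
  (forall x, y x x) ->
  exists x x', y x <> y x' /\ {in s x, y x' =1 y x}.
Proof.
move=> Kinf Ksucc Lreg KL Hc NK yN yxx.
have KnK : ~ ([set: Kplus] #<= [set: K]).
  move=> PK; case: Ksucc => _ [KP /negP KnP] _; apply: KnP.
  by rewrite card_eq_le KP.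
have Pwo : well_order (<=%O : rel Kplus) by case: Ksucc => -[].
have Linh := regular_inhabited Lreg.
have sP : small L [set: Kplus] := regular_small Lreg KL.
have sK : small L [set: K].
  by apply: small_le sP => //; case: Ksucc => _ [].
have snat : small L [set: nat].
  by apply: small_le sK => //; exact/infiniteP/Kinf.2.
have sbool : small L [set: bool].
  move=> f; have [b fb] := snat (fun n => f (n == 0)%N).
  by exists b => -[] _; [exact: (fb 0%N I)|exact: (fb 1%N I)].
(* Adding the coordinates of the condition to [N x] lets one pressing-down argument control both. *)
pose M x := N x `|` [set` s x].
have MK x : M x #<= [set: K].
  by apply: (@card_setU_le _ K) => //; apply: finite_card_le => //;
    exact: finite_seq.
have yM x (r : seq L) : exists2 z, columns c (M x) z & {in r, z =1 y x}.
  have [z Nz zr] := yN x r; exists z => //.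
  by apply: columns_subset Nz => a Na; left.
have sM x a : a \in s x -> M x a by right.
have [c0 Tcof] := pressing_down Lreg Kinf KnK KL snat MK.
set T := [set x | _] in Tcof.
pose A x := M x `&` [set a | x <= a].
have AK x : A x #<= [set: K].
  by apply: card_le_trans (MK x); apply: subset_card_le; exact: subIsetl.
have /choice[xi /choice[e eP]] :=
  fun x => order_type_lt_succ Lreg Pwo KnK (AK x).
(* On [A x], [p x] inverts the enumeration [e x]: it gives the position of an element. *)
have /choice[p pP] : forall x, exists p : L -> Kplus,
    forall a, A x a -> p a < xi x /\ e x (p a) = a.
  move=> x; suff /choice : forall a, exists i, A x a -> i < xi x /\ e x i = a.
    by move=> [p pP]; exists p.
  move=> a; have [Aa|nAa] := pselect (A x a); last by exists (xi x).
  have [_ eA] := eP x; move: (Aa); rewrite -eA => -[i ixi ei].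
  by exists i.
pose T' := T `&` [set x | c0 <= x].
have T'cof : cofinal T'.
  move=> b; have [x Tx] := Tcof (Order.max b c0).
  by rewrite ge_max => /andP[bx c0x]; exists x.
(* Below [c0] a condition is recorded literally; from [x] on, coordinates are recorded by position
   in [A x], so that different [x] can share the data. For [x] in [T'] no coordinate lies in
   between. *)
pose low x := [seq (a, y x a) | a <- s x & a < c0].
pose high x := [seq (p x a, y x a) | a <- s x & x <= a].
have [|[xi0 [low0 high0]] _ T2cof] := cofinal_pigeonhole c0
  (f := fun x => (xi x, (low x, high x)))
  (small_setX sP
    (small_setX (small_seq snat (small_setX (small_segment Lreg c0) sbool))
      (small_seq snat (small_setX sP sbool)))) T'cof.
  move=> x _; split=> //; split=> // q /mapP[a].
  by rewrite mem_filter => /andP[ac0 _] ->.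
have /choice[bnd bndP] : forall x, exists b, forall a, M x a -> a < b.
  by move=> x; exact: small_le Linh (MK x) sK id.
(* Thinning places all of [M (t x)] below [t x'] whenever [x < x'], which makes the sets [A (t x)]
   disjoint. *)
have [t [tT2 tbnd]] := cofinal_thin Lreg bnd T2cof.
(* The color depends only on the position of the lower element, so every column indexed in the later
   set copies the same pattern. *)
pose h (q : segment xi0 * segment xi0) := (set_val q.1, true) \in high0.
pose a x (i : segment xi0) := e (t x) (set_val i).
have xiE x : xi (t x) = xi0 by have [_ []] := tT2 x.
have lowE x : low (t x) = low0 by have [_ []] := tT2 x.
have highE x : high (t x) = high0 by have [_ []] := tT2 x.
have tsplit x b : M (t x) b -> b < t x -> b < c0.
  by have [[Tx _] _] := tT2 x; exact: Tx.
have c0t x : c0 <= t x by have [[_ ?] _] := tT2 x.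
have [|x|x [x' [xx' cE]]] := Hc xi0 h (A \o t) a.
- apply/trivIsetP => x x' _ _.
  wlog lt_xx' : x x' / x < x'.
    move=> wl; rewrite neq_lt => /orP[] lt.
      by apply: (wl _ _ lt); rewrite lt_eqF.
    by rewrite setIC; apply: (wl _ _ lt); rewrite lt_eqF.
  move=> _; apply/seteqP; split=> // b [[/bndP Mb _] [_ /= tb]].
  by have := lt_le_trans Mb (le_trans (tbnd x x' lt_xx') tb); rewrite ltxx.
- have [e_incr eA] := eP (t x); split=> [i j ij|].
    by apply: (e_incr _ _ ij); rewrite xiE; exact: (set_valP j).
  rewrite /= -eA xiE; apply/seteqP; split=> [_ [i _ <-]|_ [i ixi <-]].
    by exists (set_val i) => //; exact: (set_valP i).
  by exists (SigSub (mem_set ixi)).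
have zero_above z b : columns c (M (t x)) z -> bnd (t x) <= b -> z b = false.
  move=> [b' [Mb' z0 _]] bb; apply: z0; exact: le_trans (ltW (bndP _ _ Mb')) bb.
exists (t x), (t x'); split.
  (* The points differ at [t x']: there [y (t x')] is 1, while the columns for [M (t x)] already
     vanish. *)
  move=> yE; have [z Mz] := yM (t x) [:: t x'].
  move=> /(_ (t x')); rewrite mem_head => /(_ isT).
  by rewrite (zero_above _ _ Mz (tbnd x x' xx')) yE yxx.
move=> b sb; have [bc0|c0b] := ltP b c0.
  have : (b, y (t x) b) \in low (t x).
    by apply/mapP; exists b; rewrite ?mem_filter ?bc0.
  by rewrite lowE -(lowE x') => /mapP[b' _ [<- ->]].
have Mb := sM _ _ sb.
have tb : t x <= b.
  by rewrite leNgt; apply/negP => /(tsplit x b Mb); rewrite ltNge c0b.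
(* Approximate [y (t x')] by a column at [b] and [t x']. Being 1 at [t x'], it has its index [b']
   above that point, hence in [A (t x')]; as [b] is outside [M (t x')], its value at [b] is the
   color of [b] and [b'], dictated by [h]. *)
have [z Mz zE] := yM (t x') [:: b; t x'].
have zb : z b = y (t x') b by apply: zE; rewrite mem_head.
have zt : z (t x') by rewrite zE ?inE ?eqxx ?orbT.
case: Mz => b' [Mb' z0 zc].
have tb' : t x' < b' by rewrite ltNge; apply/negP => /z0; rewrite zt.
have bt : b < t x' := lt_le_trans (bndP _ _ Mb) (tbnd x x' xx').
have nMb : ~ M (t x') b by move=> /tsplit/(_ bt); rewrite ltNge c0b.
have [pxi pb] := pP _ _ (conj Mb tb).
have [pxi' pb'] := pP _ _ (conj Mb' (ltW tb')).
rewrite xiE in pxi; rewrite xiE in pxi'.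
have mem_xi0 k : k < xi0 -> k \in segment xi0 by move=> ?; exact: mem_set.
have := cE (SigSub (mem_xi0 _ pxi)) (SigSub (mem_xi0 _ pxi')).
rewrite /a /h /= pb pb' -(zc b (lt_trans bt tb') nMb) zb => ->.
rewrite -(highE x); case yb : (y (t x) b).
  by apply/mapP; exists b; rewrite ?mem_filter ?tb// yb.
(* A position determines its element, so the value 0 at [b] excludes an entry with value 1 at the
   same position. *)
apply/mapP => -[b1]; rewrite mem_filter => /andP[tb1 sb1] [p1 yb1].
have [_ pb1] := pP _ _ (conj (sM _ _ sb1) tb1).
have bb1 : b = b1 by rewrite -pb [p _ _]p1 pb1.
by move: yb; rewrite bb1 -yb1.
Qed.

(** * Topology of the Cantor cube and of its subspaces *)

Definition cylinder (L : eqType) (y : cantor_cube L) (s : seq L) :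
    set (cantor_cube L) := [set z : cantor_cube L | {in s, z =1 y}].

Lemma cylinder_nbhs (L : eqType) (y : cantor_cube L) (s : seq L) :
  nbhs y (cylinder y s).
Proof.
elim: s => [|a s IHs]; first by apply: filterS filterT => z _ b.
have ya : nbhs y [set z : cantor_cube L | z a = y a].
  apply: (@proj_continuous L (fun=> bool) a y [set y a]).
  exact: discrete_set1.
apply: filterS (filterI ya IHs) => z [za zs] b.
by rewrite inE => /orP[/eqP ->|/zs].
Qed.

(** The sets containing a cylinder around [y] form a filter that converges to [y] in each
    coordinate, hence in the product. *)
Lemma nbhs_cylinder (L : eqType) (y : cantor_cube L) (U : set (cantor_cube L)) :
  nbhs y U -> exists s : seq L, cylinder y s `<=` U.
Proof.
pose F : set_system (cantor_cube L) :=
  [set V | exists s : seq L, cylinder y s `<=` V].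
have FF : Filter F.
  split; first by exists [::].
    move=> V W [s sV] [r rW]; exists (s ++ r) => z zE; split.
      by apply: sV => a sa; apply: zE; rewrite mem_cat sa.
    by apply: rW => a ra; apply: zE; rewrite mem_cat ra orbT.
  by move=> V W VW [s sV]; exists s; exact: subset_trans VW.
suff : F --> y by apply.
apply/cvg_sup => a V [_ [[W _ <-] Wy] WV].
exists [:: a] => z /(_ a); rewrite mem_head => /(_ isT) za.
by apply: WV; rewrite /= za.
Qed.

Lemma closure_cylinder (L : eqType) (A : set (cantor_cube L))
    (y : cantor_cube L) :
  closure A y <-> forall s : seq L, exists2 z, A z & {in s, z =1 y}.
Proof.
split=> [Ay s|Ay U /nbhs_cylinder[s sU]].
  by have [z [Az zs]] := Ay _ (cylinder_nbhs y s); exists z.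
by have [z Az zs] := Ay s; exists z; split=> //; exact: sU.
Qed.

Lemma cantor_cube_compact (L : eqType) : compact [set: cantor_cube L].
Proof.
have := @tychonoff L (fun=> bool) (fun=> setT) (fun=> bool_compact).
by congr (@compact _ _); apply/seteqP; split.
Qed.

Lemma cantor_cube_hausdorff (L : eqType) : hausdorff_space (cantor_cube L).
Proof.
exact: (@hausdorff_product L (fun=> bool) (fun=> discrete_hausdorff)).
Qed.

Lemma nbhs_set_type (T : topologicalType) (X : set T) (x : set_type X)
    (V : set (set_type X)) :
  nbhs x V <-> exists2 W : set T, nbhs (set_val x) W & set_val @^-1` W `<=` V.
Proof.
split=> [[_ [[W oW <-] Wx] WV]|[W Wx WV]].
  by exists W => //; exact: open_nbhs_nbhs.
apply: filterS WV _; exact: (@initial_continuous _ _ set_val x W).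
Qed.

Lemma compact_set_type (T : topologicalType) (X C : set T) :
  C `<=` X -> compact C -> compact (set_val @^-1` C : set (set_type X)).
Proof.
move=> CX Ccpt F FF FC.
have [p [Cp pF]] := Ccpt (set_val @ F) (fmap_proper_filter _ FF) FC.
exists (SigSub (mem_set (CX p Cp)) : set_type X); split=> // A B FA.
move=> /nbhs_set_type[W Wp WB].
have FA' : F (set_val @^-1` (set_val @` A)) by apply: filterS FA => q; exists q.
have [_ [[q Aq <-] Wq]] := pF (set_val @` A) W FA' Wp.
by exists q; split=> //; exact: WB.
Qed.

(** * The dense bounded subspace and its untouchable point *)

Section Space.
Context {dk dp dl : Order.disp_t}.
Context {K : orderType dk} {Kplus : orderType dp} {L : orderType dl}.
Hypothesis (Kinf : is_infinite_cardinal K).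
Hypothesis (Ksucc : is_successor_cardinal K Kplus).
Hypothesis (Lreg : is_regular_cardinal L) (KL : card_lt [set: Kplus] [set: L]).
Variable c : set L -> bool.

Definition small_closures : set (cantor_cube L) :=
  \bigcup_(N in [set N : set L | N #<= [set: K]]) closure (columns c N).

Definition all_ones : cantor_cube L := fun=> true.

Definition witness_space : set (cantor_cube L) := all_ones |` small_closures.

(** Take a column index [b] above [s] and let [N] consist of [b] and [s]: values on [s] are then
    free. The point vanishes at [b], so the lemma gives both density and non-isolation of 1. *)
Lemma small_closures_cylinder (y : cantor_cube L) (s : seq L) :
  exists z, [/\ small_closures z, {in s, z =1 y} & z <> all_ones].
Proof.
have snat : small L [set: nat].
  have [_ [KKplus _] _] := Ksucc.
  apply: (small_le (regular_inhabited Lreg) _ (regular_small Lreg KL)).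
  by apply: card_le_trans KKplus; exact/infiniteP/Kinf.2.
have [x0] := regular_inhabited Lreg.
have [b sb] := snat (nth x0 s).
pose N := [set` b :: s].
pose z a := if a < b then if a \in s then y a else c [set a; b] else false.
exists (z : cantor_cube L); split.
- exists N; first by apply: finite_card_le Kinf _; exact: finite_seq.
  apply: subset_closure; exists b; split=> [|a|a ab Na].
  + exact: mem_head.
  + by rewrite /z ltNge => ->.
  + rewrite /z ab; case: ifPn => // sa.
    by case: Na; rewrite /N /= inE sa orbT.
- by move=> a sa; rewrite /z sa -(nth_index x0 sa) sb.
- by move=> /(congr1 (@^~ b)); rewrite /z ltxx.
Qed.

Lemma witness_space_dense : dense witness_space.
Proof.
move=> O [y Oy] oO.
have [s sO] := nbhs_cylinder (open_nbhs_nbhs (conj oO Oy)).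
have [z [Yz zs _]] := small_closures_cylinder y s.
by exists z; split; [exact: sO|right].
Qed.

(** The union [M] of the sets used by points of [S] still has size at most [K], so [S] lies in the
    compact set [C], which is contained in the space. *)
Lemma witness_space_bounded : bounded_by K (set_type witness_space).
Proof.
move=> S SK.
have /choice[N NP] : forall x : set_type witness_space, exists N : set L,
    N #<= [set: K] /\ (all_ones |` closure (columns c N)) (set_val x).
  move=> x; have [x1|[N NK Nx]] := set_valP x; last first.
    by exists N; split=> //; right.
  by exists set0; split; [exact: card_ge0|left].
pose M := \bigcup_(x in S) N x.
have MK : M #<= [set: K].
  by apply: (card_bigcup_le Kinf) => // x _; exact: (NP x).1.
pose C : set (cantor_cube L) := all_ones |` closure (columns c M).
have Ccl : closed C.
  apply: closedU; last exact: closed_closure.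
  by apply: compact_closed (@cantor_cube_hausdorff L) _; exact: compact_set1.
have Ccpt : compact C.
  exact: subclosed_compact Ccl (@cantor_cube_compact L) _.
have CX : C `<=` witness_space by apply: setUS => y My; exists M.
have val_cont : continuous (set_val : set_type witness_space -> _).
  exact: initial_continuous.
apply: (subclosed_compact _ (compact_set_type CX Ccpt)).
  exact: closed_closure.
rewrite closureE => x; apply; split.
  by apply: preimage_closed Ccl => y _; exact: val_cont.
move=> y Sy; have [_ [y1|Ny]] := NP y; [by left|right].
apply: closure_subset Ny; apply: columns_subset; exact: bigcup_sup.
Qed.

Definition all_ones_point : set_type witness_space :=
  SigSub (mem_set (or_introl erefl : witness_space all_ones)).

Lemma all_ones_not_isolated :
  ~ isolated [set: set_type witness_space] all_ones_point.
Proof.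
move=> [_ [V /nbhs_set_type[W /nbhs_cylinder[s sW] WV] V1]].
have [z [Yz zs z1]] := small_closures_cylinder all_ones s.
pose z' : set_type witness_space := SigSub (mem_set (or_intror Yz)).
suff : [set all_ones_point] z' by move=> /(congr1 set_val).
by rewrite -V1; split=> //; apply: WV; exact: sW.
Qed.

Hypothesis Hc : forall (xi : Kplus) (h : segment xi * segment xi -> bool)
    (A : L -> set L) (a : L -> segment xi -> L),
  trivIset [set: L] A ->
  (forall alpha, increasing_enumeration (A alpha) (a alpha)) ->
  exists alpha beta : L, alpha < beta /\
    forall i j : segment xi, c [set a alpha i; a beta j] = h (i, j).

Lemma all_ones_untouchable : discretely_untouchable all_ones_point.
Proof.
move=> D Ddisc Dlim.
(* Accumulation is tested on one-coordinate cylinders around 1; the point found differs from 1, so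
   it lies in [small_closures]. *)
have /choice[w wP] : forall x : L, exists w : set_type witness_space,
    [/\ D w, small_closures (set_val w) & set_val w x].
  move=> x; have [] := Dlim (set_val @^-1` cylinder all_ones [:: x]).
    by apply/nbhs_set_type; exists (cylinder all_ones [:: x]) => //;
      exact: cylinder_nbhs.
  move=> w [w1 Dw wx]; exists w; split=> //; last by rewrite wx ?mem_head.
  by have [we|//] := set_valP w; case/eqP: w1; exact: val_inj.
have /choice[N NP] : forall x, exists N : set L,
    N #<= [set: K] /\ closure (columns c N) (set_val (w x)).
  by move=> x; have [_ [N NK Nw] _] := wP x; exists N.
have /choice[s sP] : forall x, exists s : seq L,
    forall v : set_type witness_space,
    D v -> {in s, set_val v =1 set_val (w x)} -> v = w x.
  move=> x; have [Dw _ _] := wP x.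
  pose wD : set_type D := SigSub (mem_set Dw).
  (* The topology of [D] is induced twice, from the cube through the witness space, so two
     unfoldings reach a cylinder. *)
  have /nbhs_set_type[V /nbhs_set_type[W /nbhs_cylinder[s sW] WV] VD] :
    nbhs wD [set wD] by apply: open_nbhs_nbhs; split=> //; exact: Ddisc.
  exists s => v Dv vs.
  have /(congr1 set_val) // : [set wD] (SigSub (mem_set Dv) : set_type D).
  by apply: VD; apply: WV; exact: sW.
have [||x [x' [ne eq]]] :=
    columns_clash (y := fun x => set_val (w x)) s Kinf Ksucc Lreg KL
      Hc (fun x => (NP x).1).
- by move=> x r; have /closure_cylinder := (NP x).2; apply.
- by move=> x; have [] := wP x.
by apply: ne; rewrite (sP x (w x'))//; have [] := wP x'.
Qed.

End Space.

Theorem corollary2p5 (dk dp dl : Order.disp_t)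
    (kappa : orderType dk) (kappa_plus : orderType dp) (lambda : orderType dl)
    (kappa_infinite : is_infinite_cardinal kappa)
    (kappa_plusP : is_successor_cardinal kappa kappa_plus)
    (lambda_regular : is_regular_cardinal lambda)
    (kappa_plus_lt_lambda : card_lt [set: kappa_plus] [set: lambda])
    (Col_lambda_kappa : Col lambda kappa) :
  exists X : set (cantor_cube lambda),
    [/\ dense X,
        bounded_by kappa (set_type X)
      & exists x : set_type X,
          discretely_untouchable x /\ ~ isolated [set: set_type X] x ].
Proof.
have [c cP] := Col_lambda_kappa.
exists (@witness_space _ _ kappa lambda c); split.
- exact: witness_space_dense kappa_infinite kappa_plusP lambda_regular
    kappa_plus_lt_lambda c.
- exact: witness_space_bounded.
exists (all_ones_point c); split.
  exact: all_ones_untouchable kappa_infinite kappa_plusP lambda_regular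
    kappa_plus_lt_lambda c (cP _ _ kappa_plusP).
exact (all_ones_not_isolated kappa_infinite kappa_plusP lambda_regular
  kappa_plus_lt_lambda (c := c)).
Qed.
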